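(* Given an integer $d\ge4$, there exists an integral convex polytope $\mathcal{P}$ of dimension $d$ such that $\mu_{\mathrm{Hilb}}(\mathcal{P})=d-1$ and $\mu_{\mathrm{midp}}(\mathcal{P})=\mu_{\mathrm{idp}}(\mathcal{P})=d-2$.
   Context: An integral convex polytope is a convex polytope whose vertices lie in $\mathbb{Z}^N$; $k\mathcal{P}=\{k\alpha:\alpha\in\mathcal{P}\}$. A polytope $\mathcal{Q}$ has the integer decomposition property (IDP) if for every integer $k\ge1$ and every $\alpha\in k\mathcal{Q}\cap\mathbb{Z}^N$ there are $\alpha_1,\dots,\alpha_k\in\mathcal{Q}\cap\mathbb{Z}^N$ with $\alpha=\alpha_1+\cdots+\alpha_k$. $\mu_{\mathrm{midp}}(\mathcal{P})$ is the smallest $k>0$ such that $k\mathcal{P}$ has IDP; $\mu_{\mathrm{idp}}(\mathcal{P})$ is the smallest $k>0$ such that $n\mathcal{P}$ has IDP for all $n\ge k$. Let $\mathcal{C}(\mathcal{P})\subset\mathbb{R}^{N+1}$ be the cone generated by $\{(v,1): v \text{ a vertex of }\mathcal{P}\}$, with the degree of $(\alpha,n)$ being $n$; $\mu_{\mathrm{Hilb}}(\mathcal{P})$ is the maximal degree of an element of the (unique) minimal Hilbert basis of $\mathcal{C}(\mathcal{P})$. *)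

(* Defs.v *)
From HB Require Import structures.
From mathcomp Require Import all_boot all_order all_algebra.
From mathcomp Require Import finmap.
From mathcomp Require Import Rstruct.
From Stdlib Require Rdefinitions.
Notation R := Rdefinitions.R.
Set Implicit Arguments. Unset Strict Implicit. Unset Printing Implicit Defensive.
Import Order.TTheory GRing.Theory Num.Theory.
Local Open Scope ring_scope.
Local Open Scope fset_scope.

Definition lat (N : nat) := 'rV[int]_N.
Definition toR (N : nat) (a : lat N) : 'rV[R]_N := map_mx (fun z : int => z%:~R) a.

Definition polyP (N m : nat) (V : 'I_m -> lat N) : 'rV[R]_N -> Prop :=
  fun x => exists lam : 'I_m -> R,
    (forall i, 0 <= lam i) /\ \sum_(i < m) lam i = 1 /\
    x = \sum_(i < m) lam i *: toR (V i).

Definition dil (N : nat) (k : nat) (S : 'rV[R]_N -> Prop) : 'rV[R]_N -> Prop :=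
  fun x => exists y, S y /\ x = k%:R *: y.

Definition IDP (N : nat) (Q : 'rV[R]_N -> Prop) : Prop :=
  forall k : nat, (1 <= k)%N ->
  forall a : lat N, dil k Q (toR a) ->
  exists b : 'I_k -> lat N, (forall i, Q (toR (b i))) /\ a = \sum_(i < k) b i.

Definition least_pos (Pr : nat -> Prop) (m : nat) : Prop :=
  (0 < m)%N /\ Pr m /\ forall k, (0 < k)%N -> (k < m)%N -> ~ Pr k.

Definition mu_midp_eq (N m : nat) (V : 'I_m -> lat N) (mu : nat) : Prop :=
  least_pos (fun k => IDP (dil k (polyP V))) mu.

Definition mu_idp_eq (N m : nat) (V : 'I_m -> lat N) (mu : nat) : Prop :=
  least_pos (fun k => forall n, (k <= n)%N -> IDP (dil n (polyP V))) mu.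

(* The cone C(P) in R^(N+1) generated by the (v,1), v vertex of P
   (equivalently generated by the (V i, 1)). *)
Definition lift (N : nat) (a : lat N) : lat (N + 1) := row_mx a (1 : 'rV[int]_1).

Definition coneP (N m : nat) (V : 'I_m -> lat N) : 'rV[R]_(N + 1) -> Prop :=
  fun x => exists lam : 'I_m -> R,
    (forall i, 0 <= lam i) /\ x = \sum_(i < m) lam i *: toR (lift (V i)).

Definition degree (N : nat) (x : lat (N + 1)) : int := x 0 (rshift N (ord0 : 'I_1)).

Definition hilbert_basis (N m : nat) (V : 'I_m -> lat N) (H : {fset lat (N + 1)}) : Prop :=
  (forall h, h \in H -> coneP V (toR h)) /\
  forall x : lat (N + 1), coneP V (toR x) ->
    exists c : lat (N + 1) -> nat, x = \sum_(h <- H) h *+ c h.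

Definition minimal_hilbert_basis (N m : nat) (V : 'I_m -> lat N) (H : {fset lat (N + 1)}) : Prop :=
  hilbert_basis V H /\ forall H', H' `<` H -> ~ hilbert_basis V H'.

(* mu_Hilb(P) = mu : the (unique) minimal Hilbert basis exists, and
   the maximal degree of its elements is mu. *)
Definition mu_Hilb_eq (N m : nat) (V : 'I_m -> lat N) (mu : nat) : Prop :=
  (exists H, minimal_hilbert_basis V H) /\
  forall H, minimal_hilbert_basis V H ->
    (forall h, h \in H -> degree h <= mu%:Z) /\ (exists2 h, h \in H & degree h = mu%:Z).

Definition poly_dim (N m : nat) (V : 'I_m.+1 -> lat N) : nat :=
  \rank (\matrix_(i < m.+1, j < N) ((V i 0 j - V ord0 0 j)%:~R : R)).

(* Main.v *)
Require Import Defs.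
From mathcomp Require Import all_boot all_order all_algebra.
From mathcomp Require Import finmap.
From mathcomp Require Import zify ring.
From mathcomp Require Import Rstruct.
From Stdlib Require Import Classical.

(** Put D = d - 2 and s = D + 3, and let P be the convex hull in R^(D+1) x R of
    the points (0, s + e), ((1,...,1), e) and (e_j, e) with e in {0, 1}.  For
    (z, y) at degree n write a = n - sum z.  Every point of the cone satisfies
    z_j >= 0, a + D z_j >= 0, y >= max(0, s a) and y <= s (a + D z_j) + n.

    The points ((1,...,1), r) of degree k + 1 <= D + 1 with
    0 <= r <= k s + k + 1 lie in the cone.  Every lattice point of the cone is a
    sum of vertices, or such a point with k < D plus vertices, with the single
    exception g = ((1,...,1), D + 2) of degree D + 1, which is irreducible: over
    (1,...,1) in degree D + 1 the vertices reach the heights 0..D+1 and the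
    points with k < D reach the heights from s on.  This gives the Hilbert basis,
    and the IDP of nP for n >= D, as g is not in degree kn for k > 1.

    For n < D, the point ((1,...,1), 0) of degree D plus D (n - 1) copies of
    (e_0, 0) is in degree D n and has a = -1, y = 0.  In a decomposition into
    points of nP all summands have y = 0, hence a <= 0, so some summand has
    a = -1; then its z_j are all positive and its degree is at least D. *)

Set Implicit Arguments. Unset Strict Implicit. Unset Printing Implicit Defensive.
Import Order.TTheory GRing.Theory Num.Theory.
Local Open Scope fset_scope.
Local Open Scope ring_scope.

(** * Slices of the cone over a lattice polytope *)

(** The slice of the cone at height [t], with the height kept apart from the point: dilates of the
    polytope and the cone in one more dimension then share one predicate. *)
Definition coneLevel (N m : nat) (V : 'I_m -> lat N) (t : R) (w : 'rV[R]_N) : Prop :=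
  exists lam : 'I_m -> R,
    [/\ forall i, 0 <= lam i, \sum_(i < m) lam i = t
      & w = \sum_(i < m) lam i *: toR (V i)].

Definition coneAt (N m : nat) (V : 'I_m -> lat N) (n : int) (x : lat N) : Prop :=
  coneLevel V n%:~R (toR x).

Lemma toR_inj (N : nat) : injective (@toR N).
Proof.
move=> x y /matrixP E; apply/matrixP => i j.
by have := E i j; rewrite !mxE => /eqP; rewrite eqr_int => /eqP.
Qed.

Lemma toRD (N : nat) (x y : lat N) : toR (x + y) = toR x + toR y.
Proof. by apply/matrixP => i j; rewrite !mxE intrD. Qed.

Lemma toR0 (N : nat) : toR (0 : lat N) = 0.
Proof. by apply/matrixP => i j; rewrite !mxE. Qed.

Lemma coneLevel0 (N m : nat) (V : 'I_m -> lat N) : coneLevel V 0 0.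
Proof.
exists (fun=> 0); split=> //; first by rewrite big1.
by rewrite big1 // => i _; rewrite scale0r.
Qed.

Lemma coneLevelD (N m : nat) (V : 'I_m -> lat N) t t' w w' :
  coneLevel V t w -> coneLevel V t' w' -> coneLevel V (t + t') (w + w').
Proof.
move=> [l [l0 <- ->]] [l' [l'0 <- ->]].
exists (fun i => l i + l' i); split=> [i||].
- by rewrite addr_ge0.
- by rewrite big_split.
- by rewrite -big_split; apply: eq_bigr => i _; rewrite scalerDl.
Qed.

Lemma coneLevelZ (N m : nat) (V : 'I_m -> lat N) c t w :
  0 <= c -> coneLevel V t w -> coneLevel V (c * t) (c *: w).
Proof.
move=> c0 [l [l0 <- ->]]; exists (fun i => c * l i); split=> [i||].
- by rewrite mulr_ge0.
- by rewrite mulr_sumr.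
- by rewrite scaler_sumr; apply: eq_bigr => i _; rewrite scalerA.
Qed.

Lemma coneAt0 (N m : nat) (V : 'I_m -> lat N) : coneAt V 0 0.
Proof. by rewrite /coneAt toR0; apply: coneLevel0. Qed.

Lemma coneAtD (N m : nat) (V : 'I_m -> lat N) n p x y :
  coneAt V n x -> coneAt V p y -> coneAt V (n + p) (x + y).
Proof. by rewrite /coneAt toRD intrD; apply: coneLevelD. Qed.

Lemma coneAt_vertex (N m : nat) (V : 'I_m -> lat N) i : coneAt V 1 (V i).
Proof.
exists (fun j => (j == i)%:R); split=> [j||]; first exact: ler0n.
  by rewrite (bigD1 i) //= eqxx big1 ?addr0 // => j /negPf->.
rewrite (bigD1 i) //= eqxx scale1r big1 ?addr0 // => j /negPf->.
by rewrite scale0r.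
Qed.

Lemma coneAt_vertices (N m : nat) (V : 'I_m -> lat N) (l : seq 'I_m) :
  coneAt V (size l)%:Z (\sum_(i <- l) V i).
Proof.
elim: l => [|i l IH]; first by rewrite big_nil; apply: coneAt0.
by rewrite big_cons /= -add1n PoszD; apply: coneAtD (coneAt_vertex V i) IH.
Qed.

Lemma coneAt_ge0 (N m : nat) (V : 'I_m -> lat N) n x : coneAt V n x -> 0 <= n.
Proof.
by move=> [l [l0 ln _]]; rewrite -(ler_int R) -ln; apply: sumr_ge0.
Qed.

Lemma coneAt_deg0 (N m : nat) (V : 'I_m -> lat N) x : coneAt V 0 x -> x = 0.
Proof.
move=> [l [l0 ln lx]]; apply: toR_inj; rewrite toR0 lx big1 // => i _.
have := psumr_eq0P (fun i _ => l0 i) ln => /(_ i isT) ->.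
by rewrite scale0r.
Qed.

(** The coefficients are multiplied or divided by [n]. At [n = 0] both sides say [x = 0], and a
    vertex supplies the point to be dilated. *)
Lemma coneAt_dil (N m : nat) (V : 'I_m.+1 -> lat N) (n : nat) x :
  dil n (Defs.polyP V) (toR x) <-> coneAt V n%:Z x.
Proof.
split=> [[_ [[l [l0 [l1 ->]]] xE]]|[l [l0 ln lx]]].
  exists (fun i => n%:R * l i); split=> [i||].
  - by rewrite mulr_ge0 ?ler0n.
  - by rewrite -mulr_sumr l1 mulr1.
  - by rewrite xE scaler_sumr; apply: eq_bigr => i _; rewrite scalerA.
case: n ln => [|n] ln.
  exists (toR (V ord0)); split.
    by have [l' [l'0 l'1 l'V]] := coneAt_vertex V ord0; exists l'.
  rewrite scale0r; have -> : x = 0 by apply: (@coneAt_deg0 _ _ V); exists l.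
  exact: toR0.
have n0 : (n.+1%:R : R) != 0 by rewrite pnatr_eq0.
exists ((n.+1%:R)^-1 *: toR x); split; last by rewrite scalerA divff ?scale1r.
exists (fun i => (n.+1%:R)^-1 * l i); split; first by move=> i; rewrite mulr_ge0 ?invr_ge0 ?ler0n.
split; first by rewrite -mulr_sumr ln mulVf.
by rewrite lx scaler_sumr; apply: eq_bigr => i _; rewrite scalerA.
Qed.

Lemma dil_dil (N : nat) (S : 'rV[R]_N -> Prop) k n x :
  dil k (dil n S) x <-> dil (k * n) S x.
Proof.
split=> [[_ [[y [Sy ->]] ->]]|[y [Sy ->]]].
  by exists y; rewrite scalerA natrM.
by exists (n%:R *: y); rewrite scalerA natrM; split=> //; exists y.
Qed.

(** Every generator has last coordinate 1, so the degree is the sum of the coefficients. *)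
Lemma coneP_coneAt (N m : nat) (V : 'I_m -> lat N) (x : lat (N + 1)) :
  coneP V (toR x) <-> coneAt V (degree x) (lsubmx x).
Proof.
split=> -[l].
  move=> [l0 /matrixP lx]; exists l; split=> //.
    have := lx 0 (rshift N ord0); rewrite mxE summxE => ->.
    by apply: eq_bigr => i _; rewrite 2!mxE row_mxEr mxE mulr1.
  apply/matrixP => i j; have := lx i (lshift 1 j); rewrite !mxE !summxE => ->.
  by apply: eq_bigr => k _; rewrite 2!mxE row_mxEl 2!mxE.
move=> [l0 ln /matrixP lx]; exists l; split=> //.
apply/matrixP => i j; rewrite -(splitK j) summxE; case: (split j) => k /=.
  have E := lx i k; rewrite !mxE summxE in E; rewrite mxE E.
  by apply: eq_bigr => q _; rewrite !mxE; have := row_mxEl (V q) 1 i k; rewrite mxE => ->.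
rewrite !ord1 mxE (_ : x _ _ = degree x) // -ln.
by apply: eq_bigr => q _; rewrite 2!mxE row_mxEr mxE mulr1.
Qed.

(** Summing the vertex inequalities with the weights of [x] multiplies the constant term by the
    total weight [n]. *)
Lemma coneAt_ineq (N m : nat) (V : 'I_m -> lat N) (c : 'I_N -> int) (c0 n : int) x :
  (forall i, 0 <= \sum_(k < N) c k * V i 0 k + c0) ->
  coneAt V n x -> 0 <= \sum_(k < N) c k * x 0 k + c0 * n.
Proof.
move=> cV [l [l0 ln /rowP lx]]; rewrite -(ler_int R).
suff -> : (\sum_(k < N) c k * x 0 k + c0 * n)%:~R =
    \sum_(i < m) l i * (\sum_(k < N) c k * V i 0 k + c0)%:~R :> R.
  by apply: sumr_ge0 => i _; rewrite mulr_ge0 // ler0z.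
rewrite intrD intrM -ln mulr_sumr rmorph_sum /=.
under eq_bigr => k _.
  rewrite intrM; have -> : (x 0 k)%:~R = \sum_(i < m) l i * (V i 0 k)%:~R :> R.
    have := lx k; rewrite mxE summxE => ->.
    by apply: eq_bigr => i _; rewrite !mxE.
  rewrite mulr_sumr; over.
rewrite exchange_big -big_split; apply: eq_bigr => i _ /=.
rewrite intrD mulrDr [c0%:~R * _]mulrC rmorph_sum mulr_sumr; congr (_ + _).
by apply: eq_bigr => k _ /=; rewrite intrM mulrCA.
Qed.

Lemma vertices_split (N m : nat) (V : 'I_m -> lat N) (k n : nat) (l : seq 'I_m) :
  size l = (k * n)%N ->
  exists2 b : 'I_k -> lat N, forall i, coneAt V n%:Z (b i) &
    \sum_(i <- l) V i = \sum_(i < k) b i.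
Proof.
elim: k l => [|k IH] l ls.
  exists (fun=> 0); first by case.
  by move/size0nil: ls => ->; rewrite big_nil big_ord0.
have [b bC bE] := IH (drop n l) (ltac:(rewrite size_drop ls; lia)).
exists (fun i => if unlift ord0 i is Some j then b j
                 else \sum_(i <- take n l) V i).
  move=> i; case: (unliftP ord0 i) => [j _|_]; first exact: bC.
  rewrite -[X in coneAt V X%:Z](_ : size (take n l) = n); last first.
    by rewrite size_take ls; case: ltnP; lia.
  exact: coneAt_vertices.
rewrite big_ord_recl unlift_none -[in LHS](cat_take_drop n l) big_cat /= bE.
by congr (_ + _); apply: eq_bigr => i _; rewrite liftK.
Qed.

(** One non-vertex piece [h] of degree at most [n] does no harm: it is filled up to degree [n] with
    vertices, and the remaining vertices are cut into blocks of length [n]. For [k = 1] the point is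
    its own decomposition. *)
Lemma IDP_dil (N m : nat) (V : 'I_m.+1 -> lat N) (n : nat) :
  (forall (k : nat) x, (1 < k)%N -> coneAt V (k * n)%:Z x ->
    exists n0 h l, [/\ (n0 <= n)%N, coneAt V n0%:Z h,
      (n0 + size l = k * n)%N & x = h + \sum_(i <- l) V i]) ->
  IDP (dil n (Defs.polyP V)).
Proof.
move=> dec [|[|k]] // _ x /dil_dil /coneAt_dil xC.
  exists (fun=> x); split; last by rewrite big_ord_recl big_ord0 addr0.
  by move=> i; apply/coneAt_dil; move: xC; rewrite mul1n.
have [n0 [h [l [n0n hC lk ->]]]] := dec k.+2 x isT xC.
have [b bC bE] := @vertices_split _ _ V k.+1 n (drop (n - n0) l)
  (ltac:(rewrite size_drop; lia)).
exists (fun i => if unlift ord0 i is Some j then b j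
                 else h + \sum_(i <- take (n - n0) l) V i); split.
  move=> i; apply/coneAt_dil; case: (unliftP ord0 i) => [j _|_]; first exact: bC.
  rewrite -(subnKC n0n) PoszD subnKC //; apply: coneAtD => //.
  rewrite -[X in coneAt V X%:Z](_ : size (take (n - n0) l) = (n - n0)%N).
    exact: coneAt_vertices.
  by rewrite size_take; case: ltnP; lia.
rewrite big_ord_recl unlift_none -{1}(cat_take_drop (n - n0) l) big_cat /= bE addrA.
by congr (_ + _); apply: eq_bigr => i _; rewrite liftK.
Qed.

(** * Generation by a finite set and minimal Hilbert bases *)

Definition generated (W : nmodType) (H : {fset W}) (x : W) : Prop :=
  exists c : W -> nat, x = \sum_(h <- H) h *+ c h.

Lemma generated0 (W : nmodType) (H : {fset W}) : generated H 0.
Proof. by exists (fun=> 0%N); rewrite big1. Qed.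

Lemma generatedD (W : nmodType) (H : {fset W}) x y :
  generated H x -> generated H y -> generated H (x + y).
Proof.
move=> [c ->] [c' ->]; exists (fun h => c h + c' h)%N.
by rewrite -big_split; apply: eq_bigr => h _; rewrite mulrnDr.
Qed.

Lemma generatedMn (W : nmodType) (H : {fset W}) x k :
  generated H x -> generated H (x *+ k).
Proof.
move=> Hx; elim: k => [|k IH]; first exact: generated0.
by rewrite mulrS; apply: generatedD.
Qed.

Lemma generated_mem (W : nmodType) (H : {fset W}) x : x \in H -> generated H x.
Proof.
move=> xH; exists (fun h => (h == x) : nat).
rewrite (big_fsetD1 x) //= eqxx mulr1n big_seq big1 ?addr0 // => h.
by rewrite !inE => /andP[/negPf->].
Qed.

Lemma generated_sum (W : nmodType) (H : {fset W}) (I : eqType) (l : seq I) (F : I -> W) :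
  (forall i, i \in l -> generated H (F i)) -> generated H (\sum_(i <- l) F i).
Proof.
move=> HF; rewrite big_seq; elim/big_ind: _ => //; first exact: generated0.
exact: generatedD.
Qed.

Lemma generated_trans (W : nmodType) (H H' : {fset W}) x :
  (forall h, h \in H -> generated H' h) -> generated H x -> generated H' x.
Proof.
move=> HH' [c ->]; apply: generated_sum => h hH.
exact/generatedMn/HH'.
Qed.

Lemma conePD (N m : nat) (V : 'I_m -> lat N) x y :
  coneP V (toR x) -> coneP V (toR y) -> coneP V (toR (x + y)).
Proof.
move=> /coneP_coneAt Cx /coneP_coneAt Cy; apply/coneP_coneAt.
by rewrite /degree mxE linearD; apply: coneAtD.
Qed.

Lemma coneP0 (N m : nat) (V : 'I_m -> lat N) : coneP V (toR 0).
Proof. by apply/coneP_coneAt; rewrite /degree mxE linear0; apply: coneAt0. Qed.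

Lemma conePMn (N m : nat) (V : 'I_m -> lat N) x k :
  coneP V (toR x) -> coneP V (toR (x *+ k)).
Proof.
move=> Cx; elim: k => [|k IH]; first exact: coneP0.
by rewrite mulrS; apply: conePD.
Qed.

Lemma coneP_sum (N m : nat) (V : 'I_m -> lat N) (H : {fset lat (N + 1)})
    (c : lat (N + 1) -> nat) :
  (forall h, h \in H -> coneP V (toR h)) ->
  coneP V (toR (\sum_(h <- H) h *+ c h)).
Proof.
move=> CH; rewrite big_seq; elim/big_ind: _ => [||h hH]; first exact: coneP0.
  exact: conePD.
exact/conePMn/CH.
Qed.

Lemma coneP_degree_ge0 (N m : nat) (V : 'I_m -> lat N) x :
  coneP V (toR x) -> 0 <= degree x.
Proof. by move=> /coneP_coneAt /coneAt_ge0. Qed.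

Lemma degreeD (N : nat) (x y : lat (N + 1)) : degree (x + y) = degree x + degree y.
Proof. by rewrite /degree mxE. Qed.

(** Descent on the cardinality: a basis that is not minimal strictly contains another one. *)
Lemma minimal_hilbert_basis_exists (N m : nat) (V : 'I_m -> lat N) H :
  hilbert_basis V H -> exists H', minimal_hilbert_basis V H'.
Proof.
move: {2}#|`H| (leqnn #|`H|) => k; elim: k H => [|k IH] H Hk HH.
  exists H; split=> // H' /fproper_ltn_card; lia.
case: (classic (exists2 H', H' `<` H & hilbert_basis V H')) => [[H' H'H HH']|nH].
  by apply: (IH H') => //; have := fproper_ltn_card H'H; lia.
by exists H; split=> // H' H'H HH'; apply: nH; exists H'.
Qed.

Lemma minimal_hilbert_basis_irred (N m : nat) (V : 'I_m -> lat N) H h :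
  minimal_hilbert_basis V H -> h \in H -> ~ generated (H `\ h) h.
Proof.
move=> [[HC HG] Hmin] hH hG; apply: (Hmin (H `\ h)); first exact: fproperD1.
split=> [h'|x /HG].
  by rewrite !inE => /andP[_ /HC].
apply: generated_trans => h' h'H.
have [->//|hh'] := eqVneq h' h.
by apply: generated_mem; rewrite !inE hh'.
Qed.

(** Reads the invariant off any Hilbert basis [H], minimal or not: its degrees bound those of every
    minimal basis, and an irreducible [g] lies in every basis. *)
Lemma mu_Hilb_eq_irreducible (N m : nat) (V : 'I_m -> lat N)
    (H : {fset lat (N + 1)}) (mu : nat) (g : lat (N + 1)) :
  hilbert_basis V H -> (forall h, h \in H -> degree h <= mu%:Z) ->
  coneP V (toR g) -> g <> 0 -> degree g = mu%:Z ->
  (forall a b, coneP V (toR a) -> coneP V (toR b) -> g = a + b -> a = 0 \/ b = 0) ->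
  mu_Hilb_eq V mu.
Proof.
move=> HB Hdeg Cg g0 gdeg girr; split; first exact: minimal_hilbert_basis_exists HB.
move=> H' mH'; have [[HC HG] _] := mH'; split=> [h hH'|].
  rewrite leNgt; apply/negP => hdeg; apply: (minimal_hilbert_basis_irred mH' hH').
  have [_ /(_ h (HC h hH'))] := HB; apply: generated_trans => x xH.
  have [c xE] := HG x (HB.1 x xH).
  (* The other terms have nonnegative degree, so using [h] would push the degree of [x] above [mu].
     Hence [H] is generated without [h], and so is [h]. *)
  have ch : c h = 0%N.
    case ck: (c h) => [//|k]; have := Hdeg x xH.
    rewrite xE (big_fsetD1 h) //= ck mulrS -addrA degreeD.
    have : 0 <= degree (h *+ k + \sum_(y <- H' `\ h) y *+ c y).
      apply/(@coneP_degree_ge0 _ _ V)/conePD; first exact/conePMn/HC.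
      by apply: coneP_sum => y; rewrite !inE => /andP[_ /HC].
    by move=> r0 rle; move: hdeg; rewrite ltNge (le_trans _ rle) // lerDl.
  by exists c; rewrite xE (big_fsetD1 h) //= ch mulr0n add0r.
exists g => //; have [c gE] := HG g Cg.
have [h hH' hc] : exists2 h, h \in H' & h *+ c h <> 0.
  apply: NNPP => nh; apply: g0; rewrite gE big_seq big1 // => h hH'.
  by apply: NNPP => hc; apply: nh; exists h.
case ck: (c h) => [|k]; first by move: hc; rewrite ck mulr0n.
have h0 : h <> 0 by move=> h0; apply: hc; rewrite h0 mul0rn.
have Cr : coneP V (toR (h *+ k + \sum_(y <- H' `\ h) y *+ c y)).
  apply: conePD; first exact/conePMn/HC.
  by apply: coneP_sum => y; rewrite !inE => /andP[_ /HC].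
have gE' : g = h + (h *+ k + \sum_(y <- H' `\ h) y *+ c y).
  by rewrite {1}gE (big_fsetD1 h) //= ck mulrS addrA.
have [//|r0] := girr _ _ (HC h hH') Cr gE'.
by move: gE'; rewrite r0 addr0 => ->.
Qed.

(** * Coordinates and the vertices of the polytope *)

(* [lat D.+2] is read as pairs (z, y) with z in Z^(D+1) and y in Z; [Zc], [Yc]
   are the coordinates and [Sc] is the sum of the z-coordinates. *)
Definition point (D : nat) (z : 'I_D.+1 -> int) (y : int) : lat D.+2 :=
  \row_k (if unlift ord_max k is Some j then z j else y).

Definition Zc (D : nat) (x : lat D.+2) (j : 'I_D.+1) : int := x 0 (lift ord_max j).
Definition Yc (D : nat) (x : lat D.+2) : int := x 0 ord_max.
Definition Sc (D : nat) (x : lat D.+2) : int := \sum_(j < D.+1) Zc x j.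

Lemma Zc_point D z y j : Zc (@point D z y) j = z j.
Proof. by rewrite /Zc mxE liftK. Qed.

Lemma Yc_point D z y : Yc (@point D z y) = y.
Proof. by rewrite /Yc mxE unlift_none. Qed.

Lemma Sc_point D z y : Sc (@point D z y) = \sum_(j < D.+1) z j.
Proof. by apply: eq_bigr => j _; rewrite Zc_point. Qed.

Lemma ZcD D (x y : lat D.+2) j : Zc (x + y) j = Zc x j + Zc y j.
Proof. by rewrite /Zc mxE. Qed.
Lemma ZcB D (x y : lat D.+2) j : Zc (x - y) j = Zc x j - Zc y j.
Proof. by rewrite /Zc !mxE. Qed.
Lemma YcD D (x y : lat D.+2) : Yc (x + y) = Yc x + Yc y.
Proof. by rewrite /Yc mxE. Qed.
Lemma YcB D (x y : lat D.+2) : Yc (x - y) = Yc x - Yc y.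
Proof. by rewrite /Yc !mxE. Qed.
Lemma ScD D (x y : lat D.+2) : Sc (x + y) = Sc x + Sc y.
Proof. by rewrite /Sc -big_split; apply: eq_bigr => j _; rewrite ZcD. Qed.
Lemma ScB D (x y : lat D.+2) : Sc (x - y) = Sc x - Sc y.
Proof. by rewrite /Sc -sumrB; apply: eq_bigr => j _; rewrite ZcB. Qed.

Lemma lat_ext D (x y : lat D.+2) :
  (forall j, Zc x j = Zc y j) -> Yc x = Yc y -> x = y.
Proof.
move=> Zxy Yxy; apply/rowP => k.
by case: (unliftP ord_max k) => [j ->|->]; [apply: Zxy | apply: Yxy].
Qed.

Lemma Sc_ge D (x : lat D.+2) (al : int) :
  (forall j, al <= Zc x j) -> D.+1%:Z * al <= Sc x.
Proof.
move=> alZ; apply: (@le_trans _ _ (\sum_(j < D.+1) al)); last exact: ler_sum.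
by rewrite sumr_const card_ord -[_ *+ _]mulr_natl natz.
Qed.

Lemma sum_coords D (F : 'I_D.+2 -> int) :
  \sum_k F k = \sum_(j < D.+1) F (lift ord_max j) + F ord_max.
Proof.
rewrite big_ord_recr /=; congr (_ + _); apply: eq_bigr => j _.
by congr F; apply: val_inj; rewrite /= /bump leqNgt ltn_ord.
Qed.

(* With [D = d - 2]: [q = 0] is (0, D + 3 + e), [q = 1] is ((1,...,1), e) and
   [q = j + 2] is (e_j, e). *)
Definition vtx (D q : nat) (e : bool) : lat D.+2 :=
  @point D (fun j => ((q == 1) || (q == j.+2))%:Z)
    ((if q == 0 then D.+3%:Z else 0) + e%:Z).

Lemma vtx0E (D : nat) (e : bool) :
  (Sc (vtx D 0 e) = 0) * (forall j, Zc (vtx D 0 e) j = 0)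
  * (Yc (vtx D 0 e) = D.+3%:Z + e%:Z).
Proof.
by split; [split=> [|j]|]; rewrite ?Yc_point ?Zc_point ?Sc_point //= big1.
Qed.

Lemma vtx1E (D : nat) (e : bool) :
  (Sc (vtx D 1 e) = D.+1%:Z) * (forall j, Zc (vtx D 1 e) j = 1)
  * (Yc (vtx D 1 e) = e%:Z).
Proof.
split; [split=> [|j]|]; rewrite ?Yc_point ?Zc_point ?Sc_point ?add0r //=.
by rewrite sumr_const card_ord natz.
Qed.

Lemma vtx2E (D : nat) (j0 : 'I_D.+1) (e : bool) :
  (Sc (vtx D j0.+2 e) = 1) * (forall j, Zc (vtx D j0.+2 e) j = (j == j0)%:Z)
  * (Yc (vtx D j0.+2 e) = e%:Z).
Proof.
have E (j : 'I_D.+1) : (j0.+2 == j.+2) = (j == j0) by rewrite eqSS eqSS eq_sym val_eqE.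
split; [split=> [|j]|]; rewrite ?Yc_point ?Zc_point ?Sc_point ?add0r //= ?E //.
by rewrite (bigD1 j0) //= eqxx big1 ?addr0 // => j /negPf; rewrite -E => ->.
Qed.

Variant vtx_spec (D : nat) : nat -> Prop :=
  | Vtx0 : vtx_spec D 0
  | Vtx1 : vtx_spec D 1
  | Vtx2 (j : 'I_D.+1) : vtx_spec D j.+2.

Lemma vtxP (D q : nat) : (q < D.+3)%N -> vtx_spec D q.
Proof.
case: q => [|[|q]] lt_q; [exact: Vtx0|exact: Vtx1|].
by have lt_q' : (q < D.+1)%N by []; exact: (Vtx2 (Ordinal lt_q')).
Qed.

(** Indices [2q] and [2q + 1] carry the two copies [e = 0, 1] of vertex [q], for [2 (D + 3)]
    vertices in all. *)
Definition vtxs (D : nat) (i : 'I_(2 * D + 5).+1) : lat D.+2 := vtx D i./2 (odd i).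
Arguments vtxs : clear implicits.

Lemma vtxsP (D : nat) (q : nat) (e : bool) :
  (q < D.+3)%N -> exists i, vtxs D i = vtx D q e.
Proof.
move=> lt_q; have lt_i : (e + q.*2 < (2 * D + 5).+1)%N by case: e; lia.
by exists (Ordinal lt_i); rewrite /vtxs /= half_bit_double oddD odd_double addbF oddb.
Qed.

(** * Linear inequalities of the cone and sums of vertices *)

Lemma coneAt_coords (D : nat) (c e cy c0 : int) (j : 'I_D.+1) (n : int) x :
  (forall q b, (q < D.+3)%N -> let v := vtx D q b in
     0 <= c * Sc v + e * Zc v j + cy * Yc v + c0) ->
  coneAt (vtxs D) n x -> 0 <= c * Sc x + e * Zc x j + cy * Yc x + c0 * n.
Proof.
move=> vI; pose C k := if unlift ord_max k is Some i then c + e * (i == j)%:Z else cy.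
have CE (v : lat D.+2) : \sum_k C k * v 0 k = c * Sc v + e * Zc v j + cy * Yc v.
  rewrite sum_coords /C unlift_none -/(Yc v); congr (_ + _).
  rewrite (eq_bigr (fun i => c * Zc v i + e * ((i == j)%:Z * Zc v i))); last first.
    by move=> i _; rewrite liftK -/(Zc v i) mulrDl mulrA.
  rewrite big_split /= -!mulr_sumr -/(Sc v); congr (_ + e * _).
  by rewrite (bigD1 j) //= eqxx mul1r big1 ?addr0 // => i /negPf->; rewrite mul0r.
move=> /(@coneAt_ineq _ _ _ C c0); rewrite CE; apply=> i; rewrite CE.
by apply: vI; have := ltn_ord i; lia.
Qed.

(** Checked on vertices: in degree 1, [a = n - Sc x] is 1, [-D], 0 on the three families, and
    [a + D z_j] is 1, 0, and 0 or [D]. *)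
Lemma coneAt_facets (D : nat) (n : int) x j : coneAt (vtxs D) n x ->
  [/\ 0 <= Zc x j, 0 <= n - Sc x + D%:Z * Zc x j, 0 <= Yc x,
      D.+3%:Z * (n - Sc x) <= Yc x
    & Yc x <= D.+3%:Z * (n - Sc x + D%:Z * Zc x j) + n].
Proof.
move=> xC.
have T : forall c e cy c0, (forall q b, (q < D.+3)%N -> let v := vtx D q b in
     0 <= c * Sc v + e * Zc v j + cy * Yc v + c0) ->
     0 <= c * Sc x + e * Zc x j + cy * Yc x + c0 * n.
  by move=> c e cy c0 vI; apply: coneAt_coords xC.
split.
- have := T 0 1 0 0; rewrite !mul0r !mul1r !addr0 add0r; apply=> q b lt_q /=.
  by case: (vtxP lt_q) => [||j0]; rewrite ?vtx0E ?vtx1E ?vtx2E; lia.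
- have := T (-1) D%:Z 0 1; rewrite (_ : _ + 1 * n = n - Sc x + D%:Z * Zc x j); last by ring.
  apply=> q b lt_q /=.
  by case: (vtxP lt_q) => [||j0]; rewrite ?vtx0E ?vtx1E ?vtx2E; lia.
- have := T 0 0 1 0; rewrite !mul0r !mul1r !addr0 add0r; apply=> q b lt_q /=.
  by case: (vtxP lt_q) => [||j0]; rewrite ?vtx0E ?vtx1E ?vtx2E; lia.
- have := T D.+3%:Z 0 1 (- D.+3%:Z).
  rewrite (_ : _ + - D.+3%:Z * n = Yc x - D.+3%:Z * (n - Sc x)); last by ring.
  rewrite subr_ge0; apply=> q b lt_q /=.
  by case: (vtxP lt_q) => [||j0]; rewrite ?vtx0E ?vtx1E ?vtx2E; nia.
- have := T (- D.+3%:Z) (D.+3%:Z * D%:Z) (-1) (D.+3%:Z + 1).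
  rewrite (_ : _ + (D.+3%:Z + 1) * n = D.+3%:Z * (n - Sc x + D%:Z * Zc x j) + n - Yc x); last by ring.
  rewrite subr_ge0; apply=> q b lt_q /=.
  by case: (vtxP lt_q) => [||j0]; rewrite ?vtx0E ?vtx1E ?vtx2E; nia.
Qed.

Lemma coneAt_vtx (D q : nat) (e : bool) :
  (q < D.+3)%N -> coneAt (vtxs D) 1 (vtx D q e).
Proof. by move=> /(vtxsP e) [i <-]; apply: coneAt_vertex. Qed.

(* [al] is the number of copies of [vtx D 1 _] and [w] that of [vtx D 0 _]. *)
Lemma sum_of_vertices (D n : nat) (x : lat D.+2) (al : int) :
  let w := n%:Z - Sc x + D%:Z * al in
  0 <= al -> (forall j, al <= Zc x j) -> 0 <= w ->
  D.+3%:Z * w <= Yc x <= D.+3%:Z * w + n%:Z ->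
  exists2 l, size l = n & x = \sum_(i <- l) vtxs D i.
Proof.
elim: n x al => [|n IH] x al w al0 alZ w0 /andP[Ylo Yhi].
  have SG := Sc_ge alZ.
  (* Here [(D + 1) al <= Sc x <= D al]. *)
  have al00 : al = 0 by rewrite /w in w0; lia.
  have S0 : Sc x = 0 by rewrite /w in w0; lia.
  have Z0 j : Zc x j = 0.
    have := psumr_eq0P (P := predT) (F := Zc x) _ S0 => /(_ _ j isT); apply.
    by move=> i _; rewrite -al00.
  exists [::] => //; rewrite big_nil; apply: lat_ext => [j|].
    by rewrite Z0 /Zc mxE.
  by rewrite /Yc [RHS]mxE -/(Yc x); rewrite /w al00 S0 in Ylo Yhi; lia.
(* The vertex split off has [e = 1] exactly when the height exceeds its minimum, so the slack can
   drop from [n.+1] to [n]. *)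
pose e := D.+3%:Z * w < Yc x.
have eY : D.+3%:Z * w + e%:Z <= Yc x <= D.+3%:Z * w + e%:Z + n%:Z.
  by rewrite /e; case: ltP; lia.
suff [q [al' [lt_q al'0 al'Z w'0 Y']]] : exists q (al' : int), let v := vtx D q e in
    let w' := n%:Z - Sc (x - v) + D%:Z * al' in
    [/\ (q < D.+3)%N, 0 <= al', forall j, al' <= Zc (x - v) j, 0 <= w' &
      D.+3%:Z * w' <= Yc (x - v) <= D.+3%:Z * w' + n%:Z].
  have [l sl xE] := IH _ _ al'0 al'Z w'0 Y'.
  have [i iE] := vtxsP e lt_q.
  exists (i :: l); first by rewrite /= sl.
  by rewrite big_cons -xE iE addrCA subrr addr0.
(* Copies of [vtx D 0 _] go first, then those of [vtx D 1 _]. Once [w = al = 0], the sum of the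
   [z_j] is [n.+1], so some [z_j] is positive. *)
case: (ltP 0 w) => w1.
  exists 0%N, al => /=; rewrite YcB ScB.
  rewrite !vtx0E; split=> // [j||]; first by rewrite ZcB vtx0E subr0.
    by rewrite /w in w1; lia.
  by move: eY; rewrite /w; nia.
have {}w0 : w = 0 by lia.
have {}eY : e%:Z <= Yc x <= e%:Z + n%:Z by move: eY; rewrite w0; lia.
case: (ltP 0 al) => al1.
  exists 1%N, (al - 1) => /=; rewrite YcB ScB !vtx1E.
  have -> : n%:Z - (Sc x - D.+1%:Z) + D%:Z * (al - 1) = 0 by rewrite -w0 /w; lia.
  split=> // [|j|]; [lia| |lia].
  by rewrite ZcB vtx1E; have := alZ j; lia.
have {al1}al00 : al = 0 by lia.
have Sx : Sc x = n.+1%:Z by move: w0; rewrite /w al00; lia.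
have [j0 Zj0] : exists j0, 0 < Zc x j0.
  apply: NNPP => nj; have : Sc x <= 0; last by lia.
  by apply: sumr_le0 => j _; rewrite leNgt; apply/negP => Zj; apply: nj; exists j.
exists j0.+2, 0 => /=; rewrite YcB ScB !vtx2E Sx.
have -> : n%:Z - (n.+1%:Z - 1) + D%:Z * 0 = 0 by lia.
split=> // [|j|]; [by rewrite !ltnS -ltnS | | by lia].
by rewrite ZcB vtx2E; have := alZ j; case: eqP => [->|_]; lia.
Qed.

(** * Points over (1,...,1) and the decomposition of lattice points *)

Definition diagonal (D : nat) (r : int) : lat D.+2 := @point D (fun=> 1) r.

Lemma diagonalE (D : nat) (r : int) :
  (Sc (diagonal D r) = D.+1%:Z) * (forall j, Zc (diagonal D r) j = 1)
  * (Yc (diagonal D r) = r).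
Proof.
split; [split=> [|j]|]; rewrite ?Yc_point ?Zc_point ?Sc_point //=.
by rewrite sumr_const card_ord natz.
Qed.

Lemma coneLevel_sum (N m : nat) (V : 'I_m -> lat N) (I : finType) (t : I -> R) w :
  (forall i, coneLevel V (t i) (w i)) ->
  coneLevel V (\sum_i t i) (\sum_i w i).
Proof.
move=> C; elim/big_ind2: _ => //; first exact: coneLevel0.
by move=> *; apply: coneLevelD.
Qed.

(* At height 0 the point is a combination of [vtx D 1 false] and the
   [vtx D j.+2 false]; at the top height it is
   [vtx D 1 true + vtx D 0 true *+ k]; in between, interpolate. *)
Lemma coneAt_diagonal (D k r : nat) : (0 < D)%N -> (k <= D)%N ->
  (r <= k * D.+3 + k + 1)%N -> coneAt (vtxs D) k.+1%:Z (diagonal D r%:Z).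
Proof.
move=> D0 kD rk.
(* [T] is the top height and [th] the relative height; [ka] solves [(1 - ka) + ka (D + 1) = k + 1],
   the degree equation at height 0. *)
pose T : R := (k * D.+3 + k + 1)%:R; pose th := r%:R / T; pose ka : R := k%:R / D%:R.
have T0 : 0 < T by rewrite ltr0n; lia.
have D0R : 0 < D%:R :> R by rewrite ltr0n.
have th0 : 0 <= th by rewrite divr_ge0 ?ler0n.
have th1 : th <= 1 by rewrite ler_pdivrMr // mul1r ler_nat.
have ka0 : 0 <= ka by rewrite divr_ge0 ?ler0n.
have ka1 : ka <= 1 by rewrite ler_pdivrMr // mul1r ler_nat.
have kaD : ka * D%:R = k%:R by rewrite divfK ?gt_eqF.
have thT : th * T = r%:R by rewrite divfK ?gt_eqF.
have C q e : (q < D.+3)%N -> coneLevel (vtxs D) 1 (toR (vtx D q e)).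
  exact: coneAt_vtx.
have C2 (j : 'I_D.+1) : coneLevel (vtxs D) 1 (toR (vtx D j.+2 false)).
  by apply: C; rewrite !ltnS -ltnS.
have p1 : 0 <= (1 - th) * (1 - ka) by rewrite mulr_ge0 ?subr_ge0.
have p2 : 0 <= (1 - th) * ka by rewrite mulr_ge0 ?subr_ge0.
have := coneLevelD
  (coneLevelD (coneLevelZ p1 (C 1%N false isT))
     (coneLevelZ p2 (coneLevel_sum C2)))
  (coneLevelZ th0 (coneLevelD (C 1%N true isT)
     (coneLevelZ (ler0n _ k) (C 0%N true isT)))).
rewrite /coneAt; set t := (X in coneLevel _ X _ -> _); set w := (X in coneLevel _ _ X -> _).
have -> : t = k.+1%:~R.
  by rewrite /t sumr_const card_ord -[RHS]/(k.+1%:R) -!natr1 -kaD; ring.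
suff -> : w = toR (diagonal D r%:Z) by [].
have ZR q b j : toR (vtx D q b) 0 (lift ord_max j) = (Zc (vtx D q b) j)%:~R by rewrite mxE.
have YR q b : toR (vtx D q b) 0 ord_max = (Yc (vtx D q b))%:~R by rewrite mxE.
have wE i : w 0 i = (1 - th) * (1 - ka) * toR (vtx D 1 false) 0 i
    + (1 - th) * ka * \sum_(j < D.+1) toR (vtx D j.+2 false) 0 i
    + th * (toR (vtx D 1 true) 0 i + k%:R * toR (vtx D 0 true) 0 i).
  by rewrite /w !mxE summxE.
apply/rowP => i; rewrite wE [RHS]mxE; case: (unliftP ord_max i) => [j|] ->.
  rewrite -/(Zc _ j) diagonalE !ZR !vtx0E !vtx1E.
  rewrite (bigD1 j) //= ZR vtx2E eqxx big1 => [|j' nj'].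
    by rewrite -[X in _ * (X + 0)]/(1 : R); ring.
  by rewrite ZR vtx2E eq_sym (negPf nj').
rewrite -/(Yc _) diagonalE !YR !vtx0E !vtx1E big1 => [|j' _]; last by rewrite YR vtx2E.
rewrite -[RHS]/(r%:R) -thT /T -[false%:Z%:~R]/(0 : R) -[true%:Z%:~R]/(1 : R).
rewrite -[(_ + true%:Z)%:~R]/((D.+3 + 1)%:R : R) !natrD natrM; ring.
Qed.

(* Descent on [al], the number of copies of ((1,...,1), _): each failure to split
   off a [diagonal] of degree at most [D] forces [y] below the range of [al], and
   the ranges of consecutive values of [al] overlap except at the hole. *)
Lemma diagonal_decomposition (D n : nat) (x : lat D.+2) :
  (0 < D)%N -> coneAt (vtxs D) n%:Z x ->
  [\/ exists2 l, size l = n & x = \sum_(i <- l) vtxs D i,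
      exists k r l, [/\ (k < D)%N, (r <= k * D.+3 + k + 1)%N,
        (k.+1 + size l = n)%N & x = diagonal D r%:Z + \sum_(i <- l) vtxs D i]
    | n = D.+1 /\ x = diagonal D D.+2%:Z].
Proof.
move=> D0 xC.
have Y0 : 0 <= Yc x by case: (coneAt_facets ord0 xC).
have Ya : D.+3%:Z * (n%:Z - Sc x) <= Yc x by case: (coneAt_facets ord0 xC).
suff [al [alZ w0 Yw]] : exists al : nat, [/\ forall j, al%:Z <= Zc x j,
    0 <= n%:Z - Sc x + D%:Z * al%:Z
    & Yc x <= D.+3%:Z * (n%:Z - Sc x + D%:Z * al%:Z) + n%:Z].
  elim: al alZ w0 Yw => [|al IH] alZ w0 Yw.
    (* At [al = 0] the lower end of the range is the bound [Ya], valid on the whole cone. *)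
    constructor 1; apply: (@sum_of_vertices D n x 0) => //.
    by rewrite Yw andbT mulr0 addr0.
  have SG := Sc_ge alZ.
  (* [W] counts the copies of [vtx D 0 _] that go with [al.+1]. A diagonal of degree [k.+1] absorbs
     [k] of them, and the largest [k < D] leaves the lowest minimal height. *)
  pose W := absz (n%:Z - Sc x + D%:Z * al.+1%:Z).
  have WE : n%:Z - Sc x + D%:Z * al.+1%:Z = W%:Z by rewrite /W; lia.
  pose k := minn D.-1 W.
  have [kW kD] : (k <= W)%N /\ (k < D)%N by rewrite /k; lia.
  have nW : (W + al.+1 <= n)%N by lia.
  have [Yk|Yk] := leP (D.+3%:Z * (W%:Z - k%:Z)) (Yc x).
    (* The diagonal takes as much of the excess height as it can hold; the rest fits in the slack of
       the [n - k.+1] vertices. *)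
    pose r := minn (k * D.+3 + k + 1) (absz (Yc x - D.+3%:Z * (W%:Z - k%:Z))%R).
    rewrite WE in Yw.
    have [l sl xE] : exists2 l, size l = (n - k.+1)%N &
        x - diagonal D r%:Z = \sum_(i <- l) vtxs D i.
      apply: (@sum_of_vertices D _ _ al%:Z) => //.
      - by move=> j; rewrite ZcB diagonalE; have := alZ j; lia.
      - by rewrite ScB diagonalE; lia.
      - have -> : (n - k.+1)%N%:Z - Sc (x - diagonal D r%:Z) + D%:Z * al%:Z
            = W%:Z - k%:Z by rewrite ScB diagonalE; lia.
        rewrite YcB diagonalE /r; move: Yw Yk; rewrite /minn.
        case: ifP; nia.
    constructor 2; exists k, r, l; split=> //; first exact: geq_minl.
    - by rewrite sl; lia.
    - by rewrite -xE addrC subrK.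
  (* Since [Yc x >= 0], failure excludes [k = W]. *)
  have [WD kE] : (D <= W)%N /\ k = D.-1.
    by move: Yk; rewrite /k /minn; case: ifP; nia.
  have Yk' : Yc x <= D.+3%:Z * (W%:Z - D%:Z) + D.+2%:Z by move: Yk; rewrite kE; nia.
  have alZ' j : al%:Z <= Zc x j by have := alZ j; lia.
  have WE' : n%:Z - Sc x + D%:Z * al%:Z = W%:Z - D%:Z by lia.
  (* The range of [al] ends at [D.+3 * (W - D) + n], which covers the bound [Yk'] as soon as
     [n >= D + 2]. Otherwise [D + al + 1 <= W + al + 1 <= n <= D + 1] fixes everything. *)
  have [nD|nD] := leqP D.+2 n.
    by apply: IH => //; rewrite WE'; lia.
  have [al0 WD' nE] : [/\ al = 0%N, W = D & n = D.+1] by split; lia.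
  have Z1 j : Zc x j = 1.
    have Sx : \sum_(j < D.+1) (Zc x j - 1) = 0.
      by rewrite sumrB -/(Sc x) sumr_const card_ord natz; lia.
    apply/eqP; rewrite -subr_eq0; apply/eqP.
    have := psumr_eq0P (P := predT) _ Sx => /(_ _ j isT); apply=> i _.
    by rewrite subr_ge0; have := alZ i; rewrite al0.
  have [YD|YD] := leP (Yc x) D.+1%:Z.
    by apply: IH => //; rewrite WE' WD' ?nE; lia.
  constructor 3; split=> //; apply: lat_ext => [j|]; rewrite diagonalE //.
  by rewrite WD' in Yk'; lia.
(* The descent starts at the least [z_j], where the facet inequalities for [j0] are the required
   bounds. *)
pose j0 := [arg min_(j < ord0 : 'I_D.+1) Zc x j]%O.
have j0P j : Zc x j0 <= Zc x j by rewrite /j0; case: Order.TotalTheory.arg_minP => // i _; apply.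
have [Z0 w0 _ _ Yw] := coneAt_facets j0 xC.
have E : (absz (Zc x j0))%:Z = Zc x j0 by lia.
by exists (absz (Zc x j0)); rewrite E.
Qed.

(** * Irreducibility of the exceptional point and failure of IDP for small dilates *)

(** The values [p - Sc a] and [q - Sc b] are opposite. If they are nonzero, one summand takes all
    the [z_j] and the other has height at least [D + 3]. If both vanish and neither summand has all
    [z_j = 0], each has some [z_j = 0], so the heights are at most [p] and [q], with sum [D + 1]. *)
Lemma diagonal_irreducible (D : nat) (p q : int) (a b : lat D.+2) :
  coneAt (vtxs D) p a -> coneAt (vtxs D) q b ->
  a + b = diagonal D D.+2%:Z -> p + q = D.+1%:Z -> p = 0 \/ q = 0.
Proof.
wlog : p q a b / p - Sc a <= 0 => [hw|pa] aC bC ab pq.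
  have [pa|pa] := leP (p - Sc a) 0; first exact: (hw p q a b).
  apply/or_comm/(hw q p b a) => //; rewrite 1?addrC //.
  have := congr1 (@Sc D) ab; rewrite ScD diagonalE; lia.
have Sab : Sc a + Sc b = D.+1%:Z by rewrite -ScD ab diagonalE.
have Zab j : Zc a j + Zc b j = 1 by rewrite -ZcD ab diagonalE.
have Yab : Yc a + Yc b = D.+2%:Z by rewrite -YcD ab diagonalE.
have Za j : 0 <= Zc a j by case: (coneAt_facets j aC).
have Zb j : 0 <= Zc b j by case: (coneAt_facets j bC).
have q0 := coneAt_ge0 bC; have p0 := coneAt_ge0 aC.
have [_ _ Ya _ _] := coneAt_facets ord0 aC.
have [_ _ _ Yb _] := coneAt_facets ord0 bC.
have Z0 (c : lat D.+2) : (forall j, Zc c j = 0) -> Sc c = 0 by move=> c0; rewrite /Sc big1.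
have [{}pa|{}pa] : p - Sc a < 0 \/ p - Sc a = 0 by lia.
  have Zb0 j : Zc b j = 0.
    by have [_ + _ _ _] := coneAt_facets j aC; have := Zab j; have := Zb j; nia.
  by have Sb := Z0 b Zb0; exfalso; nia.
case: (classic (forall j, Zc b j = 0)) => [/Z0 Sb|/not_all_ex_not [j Zbj]].
  by right; lia.
case: (classic (forall j, Zc a j = 0)) => [/Z0 Sa|/not_all_ex_not [j' Zaj]].
  by left; lia.
have Zaj0 : Zc a j = 0 by have := Zab j; have := Za j; have := Zb j; lia.
have Zbj0 : Zc b j' = 0 by have := Zab j'; have := Za j'; have := Zb j'; lia.
have [_ _ _ _] := coneAt_facets j aC; have [_ _ _ _] := coneAt_facets j' bC.
rewrite Zaj0 Zbj0; nia.
Qed.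

Lemma not_IDP_dil (D n : nat) : (0 < n)%N -> (n < D)%N ->
  ~ IDP (dil n (Defs.polyP (vtxs D))).
Proof.
move=> n0 nD IDPn; have D0 : (0 < D)%N by lia.
pose x : lat D.+2 := diagonal D 0 + vtx D 2 false *+ (D * n.-1).
have Sc0 : Sc (0 : lat D.+2) = 0 by rewrite /Sc big1 // => j _; rewrite /Zc mxE.
have Yc0 : Yc (0 : lat D.+2) = 0 by rewrite /Yc mxE.
have v2E := @vtx2E D ord0 false.
have Sv c : Sc (vtx D 2 false *+ c) = c%:Z.
  by elim: c => // c IH; rewrite mulrSr ScD IH v2E; lia.
have Yv c : Yc (vtx D 2 false *+ c) = 0.
  by elim: c => // c IH; rewrite mulrSr YcD IH v2E.
have xE : (Sc x = D.+1%:Z + (D * n.-1)%N%:Z) * (Yc x = 0).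
  by rewrite /x ScD YcD !diagonalE Sv Yv.
have xC : coneAt (vtxs D) (D * n)%N%:Z x.
  have -> : (D * n)%N%:Z = D%:Z + (D * n.-1)%N%:Z by case: (n) n0 => // m _; rewrite /=; lia.
  apply: coneAtD.
    by have := @coneAt_diagonal D D.-1 0; rewrite prednK //; apply; lia.
  elim: (D * n.-1)%N => [|c IH]; first exact: coneAt0.
  by rewrite mulrSr -[c.+1]addn1 PoszD; apply: coneAtD => //; apply: (@coneAt_vtx D 2).
have [|b [bC bE]] := IDPn D D0 x; first exact/dil_dil/coneAt_dil.
have {}bC i : coneAt (vtxs D) n%:Z (b i) by apply/coneAt_dil.
(* The total is [D n - (D + 1) - D (n - 1)]. *)
have Sb : \sum_(i < D) (n%:Z - Sc (b i)) = -1.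
  rewrite sumrB -(big_morph (@Sc D) (@ScD D) Sc0) -bE xE sumr_const card_ord.
  by rewrite -mulr_natl natz; case: (n) n0 => // m _; rewrite /=; lia.
have Yb i : Yc (b i) = 0.
  have : \sum_(i < D) Yc (b i) = 0.
    by rewrite -(big_morph (@Yc D) (@YcD D) Yc0) -bE xE.
  move=> /psumr_eq0P; apply=> // i' _.
  by case: (coneAt_facets ord0 (bC i')).
have Ai i : n%:Z - Sc (b i) <= 0.
  by have [_ _ _ + _] := coneAt_facets ord0 (bC i); rewrite Yb; nia.
have [i Ai0] : exists i, n%:Z - Sc (b i) < 0.
  apply: NNPP => ni; suff : \sum_(i < D) (n%:Z - Sc (b i)) = 0 by rewrite Sb.
  rewrite big1 // => i _; apply: NNPP => Ai0; apply: ni; exists i.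
  by have := Ai i; lia.
have Ai1 : -1 <= n%:Z - Sc (b i).
  rewrite -Sb (bigD1 i) //= gerDl; exact: sumr_le0.
have : D.+1%:Z * 1 <= Sc (b i).
  apply: Sc_ge => j; have [Z0 + _ _ _] := coneAt_facets j (bC i); nia.
lia.
Qed.

(** * Passage to the cone, and the invariants of the polytope *)

Definition homogenize (N : nat) (n : int) (x : lat N) : lat (N + 1) :=
  row_mx x (n%:M : 'rV_1).

Lemma degree_homogenize N n (x : lat N) : degree (homogenize n x) = n.
Proof. by rewrite /degree row_mxEr mxE eqxx. Qed.

Lemma homogenizeK N (X : lat (N + 1)) : homogenize (degree X) (lsubmx X) = X.
Proof.
rewrite -[RHS]hsubmxK; congr row_mx; apply/rowP => i.
by rewrite ord1 !mxE eqxx.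
Qed.

Lemma homogenizeD N n p (x y : lat N) :
  homogenize (n + p) (x + y) = homogenize n x + homogenize p y.
Proof. by rewrite /homogenize raddfD add_row_mx. Qed.

Lemma homogenize0 N : homogenize 0 (0 : lat N) = 0.
Proof. by rewrite /homogenize raddf0 row_mx0. Qed.

Lemma homogenize_sum N m (V : 'I_m -> lat N) (l : seq 'I_m) :
  homogenize (size l)%:Z (\sum_(i <- l) V i) = \sum_(i <- l) Defs.lift (V i).
Proof.
elim: l => [|i l IH]; first by rewrite !big_nil homogenize0.
by rewrite !big_cons -IH /= -[(size l).+1]add1n PoszD homogenizeD.
Qed.

Lemma coneP_homogenize N m (V : 'I_m -> lat N) n x :
  coneP V (toR (homogenize n x)) <-> coneAt V n x.
Proof. by rewrite coneP_coneAt degree_homogenize row_mxKl. Qed.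

(** Relative to the base vertex (0, s), the vertex (0, s + 1) gives the last unit vector, and (e_j,
    0) gives the [j]-th one after adding [s] times the last. *)
Lemma poly_dim_vtxs D : poly_dim (vtxs D) = D.+2.
Proof.
rewrite /poly_dim; set A := (X in \rank X).
apply/eqP; rewrite -[_ == _]/(row_full A) -sub1mx; apply/row_subP => k.
have rowA i k' : row i A 0 k' = (vtxs D i 0 k')%:~R - (vtxs D ord0 0 k')%:~R.
  by rewrite !mxE intrB.
have [i1 E1] := vtxsP true (isT : (0 < D.+3)%N).
have E0 : vtxs D ord0 = vtx D 0 false by [].
have ordZ (x : lat D.+2) j : x 0 (lift ord_max j) = Zc x j by [].
have ordY (x : lat D.+2) : x 0 ord_max = Yc x by [].
have top : row ord_max 1%:M = row i1 A.
  apply/rowP => k'; rewrite rowA E1 E0 [LHS]mxE [LHS]mxE.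
  case: (unliftP ord_max k') => [j|] ->.
    by rewrite !ordZ !vtx0E (negPf (neq_lift _ _)) subrr.
  by rewrite !ordY !vtx0E eqxx -intrB [_ + false%:Z]addr0 addrC addKr.
case: (unliftP ord_max k) => [j|] ->; last by rewrite top row_sub.
have [i2 E2] := @vtxsP D j.+2 false (ltac:(by rewrite !ltnS -ltnS)).
suff -> : row (lift ord_max j) 1%:M = row i2 A + (D.+3%:R : R) *: row i1 A.
  by rewrite addmx_sub ?scalemx_sub ?row_sub.
rewrite -top; apply/rowP => k'; rewrite [RHS]mxE rowA E2 E0 [LHS]mxE [LHS]mxE.
rewrite [X in _ + X]mxE [X in _ + _ * X]mxE [X in _ + _ * X]mxE.
case: (unliftP ord_max k') => [j'|] ->.
  rewrite !ordZ vtx0E vtx2E (inj_eq lift_inj) (negPf (neq_lift _ _)) mulr0 addr0 subr0.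
  by rewrite eq_sym.
rewrite !ordY !vtx0E vtx2E eqxx eq_sym (negPf (neq_lift _ _)) mulr1.
by rewrite [D.+3%:Z + _]addr0 sub0r addNr.
Qed.

Lemma IDP_dil_vtxs (D n : nat) : (1 < D)%N -> (D <= n)%N ->
  IDP (dil n (Defs.polyP (vtxs D))).
Proof.
move=> D1 Dn; apply: IDP_dil => k x k1 xC.
have [[l sl xE]|[k' [r [l [k'D rk sl xE]]]]|[kn _]] :=
  diagonal_decomposition (ltnW D1) xC.
- by exists 0%N, 0, l; split=> //; [exact: coneAt0 | rewrite add0r].
- exists k'.+1, (diagonal D r%:Z), l; split=> //; first by lia.
  by apply: coneAt_diagonal => //; lia.
(* The exceptional degree is out of reach: [k n >= 2 D > D + 1]. *)
- by exfalso; nia.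
Qed.

Lemma mu_Hilb_vtxs (D : nat) : (0 < D)%N -> mu_Hilb_eq (vtxs D) D.+1.
Proof.
move=> D0.
pose Hv := [seq Defs.lift (vtxs D i) | i <- enum 'I_(2 * D + 5).+1].
(* The lengths of the [iota] make the bounds [k <= D] and [r <= k * D.+3 + k + 1] inclusive; the
   exceptional point is the case [k = D], [r = D.+2]. *)
pose Hd := [seq homogenize k.+1%:Z (diagonal D r%:Z) |
  k <- iota 0 D.+1, r <- iota 0 (k * D.+3 + k + 2)].
pose H := [fset x in Hv ++ Hd].
have HdP k r : (k <= D)%N -> (r <= k * D.+3 + k + 1)%N ->
    homogenize k.+1%:Z (diagonal D r%:Z) \in H.
  move=> kD rk; rewrite in_fset mem_cat; apply/orP; right.
  by apply/allpairsPdep; exists k, r; rewrite !mem_iota; split=> //; lia.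
have HvP i : Defs.lift (vtxs D i) \in H.
  by rewrite in_fset mem_cat; apply/orP; left; apply: map_f; rewrite mem_enum.
have HP x : x \in H -> (exists i, x = Defs.lift (vtxs D i)) \/
    exists k r, [/\ (k <= D)%N, (r <= k * D.+3 + k + 1)%N
      & x = homogenize k.+1%:Z (diagonal D r%:Z)].
  rewrite in_fset mem_cat => /orP[/mapP[i _ ->]|]; first by left; exists i.
  move=> /allpairsPdep[k [r [+ + ->]]]; rewrite !mem_iota => kD rk.
  by right; exists k, r; split=> //; lia.
have gC : coneAt (vtxs D) D.+1%:Z (diagonal D D.+2%:Z).
  by apply: coneAt_diagonal => //; nia.
apply: (@mu_Hilb_eq_irreducible _ _ _ H _ (homogenize D.+1%:Z (diagonal D D.+2%:Z))).
- split=> [h /HP[[i ->]|[k [r [kD rk ->]]]]|X /coneP_coneAt XC].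
  + exact/coneP_homogenize/coneAt_vertex.
  + exact/coneP_homogenize/coneAt_diagonal.
  rewrite -[X]homogenizeK; have := coneAt_ge0 XC.
  case: (degree X) XC => // n XC _.
  have Hl (l : seq 'I_(2 * D + 5).+1) :
      generated H (homogenize (size l)%:Z (\sum_(i <- l) vtxs D i)).
    by rewrite homogenize_sum; apply: generated_sum => i _; apply: generated_mem.
  have [[l <- ->]|[k [r [l [kD rk <- ->]]]]|[-> ->]] :=
    diagonal_decomposition D0 XC.
  + exact: Hl.
  + rewrite PoszD homogenizeD; apply: generatedD (Hl l).
    by apply/generated_mem/HdP => //; lia.
  + by apply/generated_mem/HdP => //; nia.
- move=> h /HP[[i ->]|[k [r [kD _ ->]]]]; rewrite degree_homogenize //; lia.
- exact/coneP_homogenize.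
- by move=> /(congr1 (@degree _)); rewrite degree_homogenize /degree mxE.
- exact: degree_homogenize.
- move=> a b /coneP_coneAt aC /coneP_coneAt bC gE.
  have [||a0|b0] := diagonal_irreducible aC bC.
  + by rewrite -raddfD -gE /= row_mxKl.
  + by rewrite -degreeD -gE degree_homogenize.
  + left; by rewrite a0 in aC; rewrite -[a]homogenizeK a0 (coneAt_deg0 aC) homogenize0.
  + right; by rewrite b0 in bC; rewrite -[b]homogenizeK b0 (coneAt_deg0 bC) homogenize0.
Qed.

Local Close Scope ring_scope.

Theorem theorem2p6 (d : nat) : (4 <= d)%N ->
  exists (N m : nat) (V : 'I_m.+1 -> lat N),
    poly_dim V = d /\
    mu_Hilb_eq V (d - 1) /\
    mu_midp_eq V (d - 2) /\
    mu_idp_eq V (d - 2).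
Proof.
case: d => [|[|D]] // D2; rewrite subn1 subn2 /=.
exists D.+2, (2 * D + 5)%N, (vtxs D).
split; first exact: poly_dim_vtxs.
split; first by apply: mu_Hilb_vtxs; lia.
split; split; [lia| |lia|]; split.
- by apply: IDP_dil_vtxs.
- by move=> k k0 kD; apply: not_IDP_dil.
- by move=> n Dn; apply: IDP_dil_vtxs.
- by move=> k k0 kD /(_ k (leqnn k)); apply: not_IDP_dil.
Qed.
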